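(* Let $h>0$ and let $v=(v_{i,j})_{i,j\in\mathbb{Z}}\in\ell_h^2$ be compactly supported (i.e. only finitely many entries are non-zero). Then $$-\langle \Delta^{(2)}_h v, v \rangle_{\ell_h^2}\;\geq\; C_h\,\|v\|_{\ell_h^2}^2,$$ where the constant $$C_h=\frac{2e^h}{(e^h+1)(1+e^{h/2})^2}$$ is optimal (it cannot be replaced by a larger constant valid for all compactly supported $v\in\ell_h^2$) and satisfies $\displaystyle\lim_{h\to0}C_h=\frac14$.
   Context: Put $\rho(h)=2\sinh(h/2)$ for $h>0$. Sequences are real-valued. The space of grid functions is $$\ell_h^2=\Big\{(v_{i,j})_{i,j\in\mathbb{Z}}:\ \|v\|_{\ell_h^2}^2=\langle v,v\rangle_{\ell_h^2}<\infty\Big\},\qquad \langle u,v\rangle_{\ell_h^2}=\sum_{i,j\in\mathbb{Z}}\rho(h)^2e^{-jh}\,u_{i,j}v_{i,j}.$$ The second discrete Laplacian (on the hyperbolic plane) is $$(\Delta^{(2)}_h v)_{i,j}=\frac{1}{\rho(h)^2}\Big[e^{2jh}\big(v_{i+1,j}+v_{i-1,j}-2v_{i,j}\big)+\frac{2}{e^h+1}v_{i,j+1}+\frac{2e^h}{e^h+1}v_{i,j-1}-2v_{i,j}\Big],\quad i,j\in\mathbb{Z}.$$ *)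

(* Defs.v *)
From HB Require Import structures.
From mathcomp Require Import all_boot all_order all_algebra.
From mathcomp Require Import all_classical all_reals all_analysis.

Set Implicit Arguments.
Unset Strict Implicit.
Unset Printing Implicit Defensive.

Import Order.TTheory GRing.Theory Num.Theory.
Import numFieldNormedType.Exports.

Local Open Scope classical_set_scope.
Local Open Scope ring_scope.

Definition sinh (R : realType) (x : R) : R := (expR x - expR (- x)) / 2.

Definition rho (R : realType) (h : R) : R := 2 * sinh (h / 2).

Definition grid_term (R : realType) (h : R) (u v : int -> int -> R)
    (p : int * int) : R :=
  rho h ^+ 2 * expR (- (p.2%:~R * h)) * u p.1 p.2 * v p.1 p.2.

(* Unordered sum of a real family over an arbitrary index type, as the
   difference of the sums of the positive and negative parts; meaningful only
   for absolutely summable families. *)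
Definition real_sum (R : realType) (T : choiceType) (f : T -> R) : R :=
  fine (esum [set: T] (EFin \o f)^\+ - esum [set: T] (EFin \o f)^\-)%E.

Definition ell2 (R : realType) (h : R) : set (int -> int -> R) :=
  [set v | summable [set: int * int] (EFin \o grid_term h v v)].

(* For [u] and [v] in [ell2 h] the family summed here is absolutely summable,
   by the Cauchy-Schwarz inequality. *)
Definition inner (R : realType) (h : R) (u v : int -> int -> R) : R :=
  real_sum (grid_term h u v).

Definition ell2norm (R : realType) (h : R) (v : int -> int -> R) : R :=
  Num.sqrt (inner h v v).

Definition compactly_supported (R : realType) (v : int -> int -> R) : Prop :=
  finite_set [set p : int * int | v p.1 p.2 != 0].

Definition laplacian2 (R : realType) (h : R) (v : int -> int -> R) :
    int -> int -> R := fun i j =>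
  (rho h ^+ 2)^-1 *
  (expR (2 * j%:~R * h) * (v (i + 1) j + v (i - 1) j - 2 * v i j)
   + 2 / (expR h + 1) * v i (j + 1)
   + 2 * expR h / (expR h + 1) * v i (j - 1)
   - 2 * v i j).

Definition hardy_const (R : realType) (h : R) : R :=
  2 * expR h / ((expR h + 1) * (1 + expR (h / 2)) ^+ 2).

(* Main.v *)
(* Put s = e^(h/2). Since e^(jh/2) is the ground state in the j direction, the
   quadratic form has a ground state representation
     - <Lap v, v> = C_h |v|^2 + sum_(i,j) ( e^(jh) (v_(i+1,j) - v_(i,j))^2
                    + 2s/(s^2+1) e^(-jh) (v_(i,j) - v_(i,j+1)/s)^2 ),
   valid pointwise up to telescoping terms. The remainder is nonnegative, which
   is the inequality. For optimality take v_(i,j) = e^(jh/2) on the box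
   0 <= i < N, -N < j <= 0 and zero elsewhere: then |v|^2 = rho(h)^2 N^2, while
   the remainder lives on the boundary of the box (e^(jh) <= 1 there) and is
   O(N). *)
Require Import Defs.
From HB Require Import structures.
From mathcomp Require Import all_boot all_order all_algebra.
From mathcomp Require Import all_classical all_reals all_analysis.
From mathcomp Require Import finmap ring lra zify.
Import Order.TTheory GRing.Theory Num.Theory.
Import numFieldNormedType.Exports.
Local Open Scope classical_set_scope.
Local Open Scope ring_scope.

(** * Finitely supported families and their sums *)

Definition finsupp {T : choiceType} {R : realType} (f : T -> R) : Prop :=
  finite_set [set x | f x != 0].

Lemma finsupp_sub {T : choiceType} {R : realType} (f g : T -> R) :
  (forall x, g x = 0 -> f x = 0) -> finsupp g -> finsupp f.
Proof.
move=> gf; apply: sub_finite_set => x /=.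
by apply: contra_neq; exact: gf.
Qed.

Lemma finsuppD {T : choiceType} {R : realType} (f g : T -> R) :
  finsupp f -> finsupp g -> finsupp (f \+ g).
Proof.
move=> ff fg; apply: (@sub_finite_set _ _ ([set x | f x != 0] `|` [set x | g x != 0])).
  move=> x /=; have [->|] := eqVneq (f x) 0; last by left.
  by rewrite add0r; right.
by rewrite finite_setU.
Qed.

Lemma finsupp_translate {R : realType} (V : zmodType) (a : V)
  (f : V -> R) : finsupp f -> finsupp (fun x => f (x + a)).
Proof.
move=> ff; apply: (@sub_finite_set _ _ ((fun x => x - a) @` [set x | f x != 0])).
  by move=> x /= fx; exists (x + a) => //; rewrite addrK.
exact: finite_image.
Qed.

(** The outer [g] lets one statement serve the absolute value, the positive part and the negative
    part; [g 0 = 0] keeps the support inside that of [f]. *)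
Lemma esum_finsupp {T : choiceType} {R : realType} (f : T -> R) (g : R -> R) :
  finsupp f -> g 0 = 0 -> (forall x, 0 <= g x) ->
  (\esum_(x in [set: T]) (g (f x))%:E = (\sum_(x \in [set: T]) g (f x))%:E)%E.
Proof.
move=> ff g0 g_ge0.
have gf x : x \notin fset_set [set x | f x != 0] -> g (f x) = 0.
  rewrite in_fset_set// notin_setE /= => /negP.
  by rewrite negbK => /eqP ->.
have -> : \sum_(x \in [set: T]) g (f x) =
    \sum_(x <- fset_set [set x | f x != 0]) g (f x) by exact: fsbigTE.
rewrite -sumEFin -fsbig_finite// -esum_fset//; last by move=> x _; rewrite lee_fin.
rewrite [RHS]esum_mkcond; apply: eq_esum => x _; case: ifPn => //.
by rewrite -in_fset_set// => /gf ->.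
Qed.

Lemma summable_finsupp {T : choiceType} {R : realType} (f : T -> R) :
  finsupp f -> summable [set: T] (EFin \o f).
Proof.
move=> ff; rewrite /summable (eq_esum (b := fun x => (`|f x|)%:E))//.
by rewrite (esum_finsupp _ (fun x => `|x|))// ?normr0// ltry.
Qed.

(** Both sums can be taken over the union of the supports. Finiteness matters, since a sum with
    infinite support defaults to 0. *)
Lemma fsumD {T : choiceType} {R : realType} (f g : T -> R) :
  finsupp f -> finsupp g ->
  \sum_(x \in [set: T]) (f x + g x) =
  \sum_(x \in [set: T]) f x + \sum_(x \in [set: T]) g x.
Proof.
move=> ff fg.
pose A := [set x | f x != 0] `|` [set x | g x != 0].
have fA : finite_set A by rewrite finite_setU.
have zA x : x \notin fset_set A -> f x = 0 /\ g x = 0.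
  rewrite in_fset_set// notin_setE /A /= => /not_orP[/negP + /negP].
  by rewrite !negbK => /eqP -> /eqP ->.
have sumA (F : T -> R) : (forall x, x \notin fset_set A -> F x = 0) ->
  \sum_(x \in [set: T]) F x = \sum_(x <- fset_set A) F x by move=> ?; exact: fsbigTE.
by rewrite !sumA ?big_split// => x /zA[fx gx]; rewrite ?fx ?gx ?addr0.
Qed.

Lemma real_sum_finsupp {T : choiceType} {R : realType} (f : T -> R) :
  finsupp f -> real_sum f = \sum_(x \in [set: T]) f x.
Proof.
move=> ff; rewrite /real_sum.
rewrite (eq_esum (b := fun x => (Num.max (f x) 0)%:E)); last first.
  by move=> x _; rewrite funeposE EFin_max.
rewrite (eq_esum (b := fun x => (Num.max (- f x) 0)%:E) (a := _^\-%E)); last first.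
  by move=> x _; rewrite funenegE EFin_max.
rewrite (esum_finsupp _ (fun x => Num.max x 0))// ?maxxx//; last first.
  by move=> x; rewrite le_max lexx orbT.
rewrite (esum_finsupp _ (fun x => Num.max (- x) 0))// ?oppr0 ?maxxx//; last first.
  by move=> x; rewrite le_max lexx orbT.
rewrite /= -mulN1r mulr_fsumr -fsumD; first last.
- by apply: finsupp_sub ff => x ->; rewrite oppr0 maxxx mulr0.
- by apply: finsupp_sub ff => x ->; rewrite maxxx.
apply: eq_fsbigr => x _; rewrite /Order.max.
by case: ltP => ?; case: ltP => ?; lra.
Qed.

(** Translation by [a] permutes [V]. With [V] the lattice of index pairs this covers both coordinate
    directions. *)
Lemma fsum_telescope {R : realType} (V : zmodType) (a : V) (f : V -> R) :
  finsupp f -> \sum_(x \in [set: V]) (f (x + a) - f x) = 0.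
Proof.
move=> ff; rewrite (@fsumD _ _ (fun x => f (x + a)) (\- f)); last 2 first.
- exact: finsupp_translate.
- by apply: finsupp_sub ff => x /= ->; rewrite oppr0.
rewrite -(@reindex_fsbigT _ _ _ _ _ (fun x => x + a)).
  by under [X in _ + X]eq_fsbigr do rewrite /= -mulN1r; rewrite -mulr_fsumr mulN1r subrr.
by exists (fun x => x - a) => x; rewrite ?addrK ?subrK.
Qed.

Lemma fsum_le_size {T : choiceType} {R : realType} (f : T -> R) (r : seq T) (c : R) :
  (forall x, f x != 0 -> x \in r) -> (forall x, 0 <= f x <= c) ->
  \sum_(x \in [set: T]) f x <= c * (size r)%:R.
Proof.
move=> fr fc; rewrite (@fsbigE _ _ _ _ _ (undup r)) ?undup_uniq//; last first.
  by move=> x _; rewrite mem_undup; apply: contraNeq; exact: fr.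
(* The sign of [c] is read off the bounds at a point, so a nonempty [r] is needed to supply one. *)
case: r fr => [|x0 r'] fr; first by rewrite big_nil mulr0.
set r := x0 :: r'.
have c0 : 0 <= c by have /andP[] := fc x0; exact: le_trans.
rewrite big_mkcond /=.
apply: (@le_trans _ _ (\sum_(x <- undup r) c)).
  by apply: ler_sum => x _; case: ifP => _ //; case/andP: (fc x).
rewrite big_const_seq count_predT iter_addr_0 -[leLHS]mulr_natr.
by rewrite ler_wpM2l// ler_nat size_undup.
Qed.

(** * Ground state representation of the quadratic form *)

Definition energy {R : realType} (h : R) (v : int -> int -> R) (p : int * int) : R :=
  expR (p.2%:~R * h) * (v (p.1 + 1) p.2 - v p.1 p.2) ^+ 2 +
  2 * expR (h / 2) / (expR h + 1) *
    (expR (- (p.2%:~R * h)) * (v p.1 p.2 - v p.1 (p.2 + 1) / expR (h / 2)) ^+ 2).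

(** Boundary term of summation by parts in [i]; [yflux] is its analogue in [j], twisted by the
    ground state. *)
Definition xflux {R : realType} (h : R) (v : int -> int -> R) (p : int * int) : R :=
  expR (p.2%:~R * h) * (v (p.1 - 1) p.2 - v p.1 p.2) * v p.1 p.2.

Definition yflux {R : realType} (h : R) (v : int -> int -> R) (p : int * int) : R :=
  2 * expR (h / 2) / (expR h + 1) * expR (- (p.2%:~R * h)) *
  (expR (h / 2) * v p.1 (p.2 - 1) - v p.1 p.2) * v p.1 p.2.

Lemma expR_half_sqr {R : realType} (h : R) : expR h = expR (h / 2) ^+ 2.
Proof. by rewrite -expRM_natl mulrC divfK ?pnatr_eq0. Qed.

(** With s = e^(h/2), the squares and fluxes reproduce all off-diagonal terms. In the [j] direction
    the diagonal keeps e^(-jh) v^2 times 2 - 4s/(s^2+1) = 2(s-1)^2/(s^2+1), which is C_h rho(h)^2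
    because rho(h) = s - 1/s. *)
Lemma laplacian2_energy {R : realType} (h : R) (v : int -> int -> R) (p : int * int) :
  0 < h ->
  - grid_term h (laplacian2 h v) v p =
  hardy_const h * grid_term h v v p + energy h v p +
  (xflux h v (p + (1, 0)) - xflux h v p) +
  (yflux h v (p + (0, 1)) - yflux h v p).
Proof.
move=> h0; case: p => i j.
rewrite /grid_term /energy /xflux /yflux /laplacian2 /hardy_const /rho /sinh /=.
have -> : (j + 1)%:~R * h = j%:~R * h + h by rewrite intrD mulrDl mul1r.
rewrite !addr0 !addrK opprD -(mulrA 2) expRM_natl !expRD !expRN.
rewrite (expR_half_sqr h).
(* The identity is now rational in [s] and [X]; [1 < s] keeps rho(h) nonzero. *)
set s := expR (h / 2); set X := expR (j%:~R * h).
have s1 : 1 < s by rewrite expR_gt1 divr_gt0.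
have X0 : 0 < X by exact: expR_gt0.
by field; apply/and5P; split; rewrite gt_eqF//; nra.
Qed.

Lemma inner_laplacian2 {R : realType} (h : R) (v : int -> int -> R) :
  0 < h -> compactly_supported v ->
  - inner h (laplacian2 h v) v =
  hardy_const h * inner h v v + \sum_(p \in [set: int * int]) energy h v p.
Proof.
move=> h0 cv.
have vs (f : int * int -> R) : (forall p, v p.1 p.2 = 0 -> f p = 0) -> finsupp f.
  by move=> fv; exact: finsupp_sub fv cv.
have ft u : finsupp (grid_term h u v) by apply: vs => p vp; rewrite /grid_term vp mulr0.
have fx : finsupp (xflux h v) by apply: vs => p vp; rewrite /xflux vp mulr0.
have fy : finsupp (yflux h v) by apply: vs => p vp; rewrite /yflux vp mulr0.
have dxf (a : int * int) (f : int * int -> R) :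
    finsupp f -> finsupp (fun p => f (p + a) - f p).
  move=> ff; apply: (finsuppD (fun p => f (p + a)) (\- f)).
    exact: finsupp_translate.
  by apply: finsupp_sub ff => p /= ->; rewrite oppr0.
have fc : finsupp (fun p => hardy_const h * grid_term h v v p).
  by apply: finsupp_sub (ft v) => p ->; rewrite mulr0.
(* The energy at [p] also sees [v] at [p + (1, 0)] and [p + (0, 1)], so its support can exceed that
   of [v] and translates are needed. *)
have fe : finsupp (energy h v).
  apply: (finsuppD (fun p => expR (p.2%:~R * h) * _) (fun p => _ * (_ * _))).
    apply: finsupp_sub (dxf (1, 0) _ cv) => -[i j] /= vv.
    by rewrite -[X in v _ X]addr0 vv expr0n mulr0.
  have fs : finsupp (fun p => - (v (p + (0, 1)).1 (p + (0, 1)).2 / expR (h / 2))).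
    by apply: finsupp_sub (finsupp_translate _ (0, 1) _ cv) => p ->; rewrite mul0r oppr0.
  apply: finsupp_sub (finsuppD _ _ cv fs) => -[i j] /=; rewrite addr0 => ->.
  by rewrite expr0n !mulr0.
rewrite /inner !real_sum_finsupp// -mulN1r !mulr_fsumr.
(* Zero is inserted as the two flux sums, so that the pointwise identity applies under a single
   sum. *)
rewrite -[RHS]addr0 -[X in _ = _ + X](fsum_telescope _ (1, 0) _ fx).
rewrite -[RHS]addr0 -[X in _ = _ + X](fsum_telescope _ (0, 1) _ fy).
have fce := finsuppD _ _ fc fe.
have fcex := finsuppD _ _ fce (dxf (1, 0) _ fx).
rewrite -(fsumD _ _ fc fe) -(fsumD _ _ fce (dxf _ _ fx)).
rewrite -(fsumD _ _ fcex (dxf _ _ fy)).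
by apply: eq_fsbigr => p _; rewrite mulN1r laplacian2_energy.
Qed.

Lemma ell2norm_sqr {R : realType} (h : R) (v : int -> int -> R) :
  compactly_supported v -> ell2norm h v ^+ 2 = inner h v v.
Proof.
move=> cv; rewrite /ell2norm sqr_sqrtr// /inner real_sum_finsupp; last first.
  by apply: finsupp_sub cv => p vp; rewrite /grid_term vp mulr0.
apply: fsumr_ge0 => p _; rewrite /grid_term -mulrA -expr2.
by rewrite mulr_ge0 ?sqr_ge0// mulr_ge0 ?sqr_ge0 ?expR_ge0.
Qed.

Lemma energy_ge0 {R : realType} (h : R) (v : int -> int -> R) (p : int * int) :
  0 <= energy h v p.
Proof.
apply: addr_ge0; first by rewrite mulr_ge0 ?sqr_ge0 ?expR_ge0.
apply: mulr_ge0; last by rewrite mulr_ge0 ?sqr_ge0 ?expR_ge0.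
by rewrite divr_ge0 ?addr_ge0 ?mulr_ge0 ?expR_ge0.
Qed.

(** * The truncated ground state and its energy *)

(* The box lies in [j <= 0], where the weight [e^(jh)] is at most 1. *)
Definition in_box (N : nat) (i j : int) : bool :=
  (0 <= i < N%:Z) && (0 <= - j < N%:Z).

Definition box_state {R : realType} (h : R) (N : nat) (i j : int) : R :=
  (in_box N i j)%:R * expR (j%:~R * (h / 2)).

Definition box_seq (N : nat) : seq (int * int) :=
  [seq (i%:Z, - j%:Z) | i <- iota 0 N, j <- iota 0 N].

(* May have repetitions: only its O(N) size matters. *)
Definition box_edges (N : nat) : seq (int * int) :=
  [seq (- 1, - k%:Z) | k <- iota 0 N] ++ [seq (N%:Z - 1, - k%:Z) | k <- iota 0 N] ++
  [seq (k%:Z, 0) | k <- iota 0 N] ++ [seq (k%:Z, - N%:Z) | k <- iota 0 N].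

Lemma mem_box_seq (N : nat) (i j : int) : ((i, j) \in box_seq N) = in_box N i j.
Proof.
apply/allpairsP/idP => [[[a b]]/=|ij].
  by rewrite !mem_iota /in_box => -[? ? [-> ->]]; lia.
exists (`|i|%N, `|j|%N); rewrite /= !mem_iota; move: ij; rewrite /in_box => ij.
by split; [lia|lia|congr pair; lia].
Qed.

Lemma box_seq_uniq (N : nat) : uniq (box_seq N).
Proof.
apply: allpairs_uniq; rewrite ?iota_uniq// => -[a b] [c d] _ _ /= [-> /oppr_inj].
by case=> ->.
Qed.

Lemma box_state_compact {R : realType} (h : R) (N : nat) :
  compactly_supported (box_state h N).
Proof.
apply: (@sub_finite_set _ _ [set` box_seq N]); last exact: finite_seq.
move=> [i j] /=; rewrite mem_box_seq /box_state.
by case: in_box => //; rewrite mul0r eqxx.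
Qed.

(** The weight e^(-jh) cancels the square of e^(jh/2), so each of the N^2 box points contributes
    rho(h)^2. *)
Lemma inner_box_state {R : realType} (h : R) (N : nat) :
  inner h (box_state h N) (box_state h N) = (rho h * N%:R) ^+ 2.
Proof.
have boxE p : p \in box_seq N ->
    grid_term h (box_state h N) (box_state h N) p = rho h ^+ 2.
  case: p => i j; rewrite mem_box_seq /grid_term /box_state /= => ->.
  rewrite !mul1r -2!mulrA -!expRD.
  by rewrite -mulrDr -splitr addNr expR0 mulr1.
have cv := box_state_compact h N.
rewrite /inner real_sum_finsupp; last first.
  by apply: finsupp_sub cv => p vp; rewrite /grid_term vp mulr0.
rewrite (@fsbigE _ _ _ _ _ (box_seq N)) ?box_seq_uniq//; last first.
  move=> [i j] _; rewrite mem_box_seq /grid_term /box_state => /negPf /= ->.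
  by rewrite mul0r mulr0.
rewrite big_mkcond big_seq (eq_bigr (fun=> rho h ^+ 2)); last first.
  by move=> p pN; rewrite in_setT boxE.
rewrite -big_seq big_const_seq count_predT iter_addr_0 size_allpairs size_iota.
by rewrite -[LHS]mulr_natr natrM -expr2 -exprMn.
Qed.

(** Up to factors at most 1, the two squares are squared differences of the box indicator: each is
    at most 1, and both vanish off the edges. *)
Lemma energy_box_state {R : realType} (h : R) (N : nat) (p : int * int) : 0 < h ->
  energy h (box_state h N) p <= (p \in box_edges N)%:R * 2.
Proof.
case: p => i j h0; rewrite /energy /box_state /=.
have -> : (j + 1)%:~R * (h / 2) = j%:~R * (h / 2) + h / 2.
  by rewrite intrD mulrDl mul1r.
have -> : j%:~R * h = j%:~R * (h / 2) + j%:~R * (h / 2) by rewrite -mulrDr -splitr.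
rewrite opprD !expRD expRN (expR_half_sqr h).
have: in_box N (i + 1) j || in_box N i j || in_box N i (j + 1) ->
    expR (j%:~R * (h / 2)) <= 1.
  move=> b; rewrite -[leRHS]expR0 ler_expR pmulr_lle0 ?divr_gt0// lerz0.
  by move: b; rewrite /in_box; lia.
(* Differences are forward, so the indicator jumps at [i = -1] and [i = N - 1], and at [j = 0] and
   [j = -N]. *)
have : [|| in_box N (i + 1) j != in_box N i j |
           in_box N i j != in_box N i (j + 1)] -> (i, j) \in box_edges N.
  rewrite /box_edges !mem_cat /in_box => /orP[] b.
    have [i1|i1] := eqVneq i (- 1); apply/orP; [left|right].
      by apply/mapP; exists `|j|%N; [rewrite mem_iota|congr pair]; lia.
    by apply/orP; left; apply/mapP; exists `|j|%N; [rewrite mem_iota|congr pair]; lia.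
  apply/orP; right; apply/orP; right.
  have [j0|j0] := eqVneq j 0; apply/orP; [left|right].
    by apply/mapP; exists `|i|%N; [rewrite mem_iota|congr pair]; lia.
  by apply/mapP; exists `|i|%N; [rewrite mem_iota|congr pair]; lia.
set s := expR (h / 2); set y := expR (j%:~R * (h / 2)).
have s0 : 0 < s by exact: expR_gt0.
have y0 : 0 < y by exact: expR_gt0.
set b := in_box N i j; set bx := in_box N (i + 1) j; set bY := in_box N i (j + 1).
move=> edge yle; rewrite [X in X <= _](_ : _ = (y ^+ 2 * (bx%:R - b%:R)) ^+ 2 +
  2 * s / (s ^+ 2 + 1) * (b%:R - bY%:R) ^+ 2); last first.
  by field; rewrite !gt_eqF//; nra.
have s2 : 0 < s ^+ 2 + 1 by nra.
(* This is (s-1)^2 >= 0. *)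
have sle : 2 * s / (s ^+ 2 + 1) <= 1.
  by rewrite ler_pdivrMr ?mul1r//; have := sqr_ge0 (s - 1); nra.
have sge : 0 <= 2 * s / (s ^+ 2 + 1) by rewrite divr_ge0 ?ltW// mulr_gt0.
move: edge yle (2 * s / (s ^+ 2 + 1)) sle sge => + + c c1 c0.
(* Eight cases for the three indicators; [edge] and [yle] fire exactly when their premises compute
   to true. *)
case: b bx bY => [] [] [] /= edge yle; rewrite ?(edge isT) ?subrr ?mulr0 ?mul1r.
all: rewrite ?expr0n ?mulr0 ?addr0 ?add0r.
all: try by case: (_ \in _); rewrite ?mul1r ?mul0r.
all: have y4 : (y ^+ 2) ^+ 2 <= 1 by rewrite !exprn_ile1 ?exprn_ge0 ?(yle isT) ?ltW.
all: by rewrite ?subr0 ?mulrN1 ?sqrrN ?mulr1 ?expr1n ?mulr1; lra.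
Qed.

(** * Optimality of the constant and its limit *)

Lemma le_hardy_const_of_box_bounds {R : realType} (h C : R) : 0 < h ->
  (forall N, C * (rho h * N%:R) ^+ 2 <= hardy_const h * (rho h * N%:R) ^+ 2 +
     \sum_(p \in [set: int * int]) energy h (box_state h N) p) ->
  C <= hardy_const h.
Proof.
move=> h0 CN; rewrite leNgt; apply/negP => hC.
have rho0 : 0 < rho h.
  by rewrite /rho /sinh mulrC divfK ?pnatr_eq0// subr_gt0 ltr_expR; lra.
have d0 : 0 < (C - hardy_const h) * rho h ^+ 2 by rewrite mulr_gt0 ?subr_gt0 ?exprn_gt0.
(* [box_edges N] has 4N entries, each of energy at most 2, so the remainder is at most 8N. This N
   makes the excess (C - C_h) rho(h)^2 N^2 larger than that. *)
have := CN (Num.bound (8 / ((C - hardy_const h) * rho h ^+ 2))).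
have := archi_boundP (ltW (divr_gt0 (ltr0n _ 8) d0)).
move: (Num.bound _) => N; rewrite ltr_pdivrMr// => dN.
have N0 : 0 < N%:R :> R by rewrite -(pmulr_lgt0 _ d0); apply: lt_trans dN.
have : \sum_(p \in [set: int * int]) energy h (box_state h N) p <=
    2 * (size (box_edges N))%:R.
  apply: fsum_le_size => p; last first.
    rewrite energy_ge0 (le_trans (energy_box_state _ _ _ h0))//.
    by case: (_ \in _); rewrite ?mul1r ?mul0r.
  apply: contraNT => /negPf pN; rewrite eq_le energy_ge0 andbT.
  by have := energy_box_state h N p h0; rewrite pN mul0r.
rewrite /box_edges !size_cat !size_map !size_iota !natrD => sumN.
by move=> /(le_trans)/(_ (lerD (lexx _) sumN)); nra.
Qed.

(** The formula is continuous at h = 0, where its value is 2/(2 * 2^2) = 1/4. *)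
Lemma hardy_const_cvg {R : realType} :
  hardy_const h @[h --> (0 : R)^'+] --> (4^-1 : R).
Proof.
have -> : 4^-1 = hardy_const (0 : R) by rewrite /hardy_const mul0r expR0; field.
apply: cvg_at_right_filter.
have ehalf : expR (h / 2) @[h --> (0 : R)] --> expR (0 / 2 : R).
  apply: continuous_cvg; first exact: continuous_expR.
  by apply: cvgM; [exact: cvg_id|exact: cvg_cst].
have e : expR h @[h --> (0 : R)] --> expR (0 : R) by exact: continuous_expR.
apply: cvgM; first by apply: cvgM; [exact: cvg_cst|].
apply: cvgV.
  by rewrite mulf_neq0 ?expf_neq0// gt_eqF// addr_gt0 ?expR_gt0.
apply: cvgM; first by apply: cvgD => //; exact: cvg_cst.
by apply: cvgM; apply: cvgD => //; exact: cvg_cst.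
Qed.

Theorem theorem5p5 (R : realType) :
  (forall h : R, 0 < h ->
     (forall v : int -> int -> R, ell2 h v -> compactly_supported v ->
        - inner h (laplacian2 h v) v >= hardy_const h * ell2norm h v ^+ 2)
     /\
     (forall C : R, hardy_const h < C ->
        ~ (forall v : int -> int -> R, ell2 h v -> compactly_supported v ->
             - inner h (laplacian2 h v) v >= C * ell2norm h v ^+ 2)))
  /\
  hardy_const h @[h --> (0 : R)^'+] --> (4^-1 : R).
Proof.
split; last exact: hardy_const_cvg.
move=> h h0; split=> [v _ cv|C hC bound].
  rewrite inner_laplacian2// ell2norm_sqr// lerDl.
  by apply: fsumr_ge0 => p _; exact: energy_ge0.
suff : C <= hardy_const h by rewrite leNgt hC.
(* The assumed bound is tested on every box state; finite support puts it in [ell2 h]. *)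
apply: le_hardy_const_of_box_bounds => // N; have cv := box_state_compact h N.
rewrite -inner_box_state -inner_laplacian2// -ell2norm_sqr//; apply: bound => //.
apply: summable_finsupp; apply: finsupp_sub cv => p vp.
by rewrite /grid_term vp mulr0.
Qed.
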